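(* Let $m,n\ge2$ and let $G$ be a grid-labelled graph of type $(m,n)$ (possibly with additional horizontal and vertical edges). (1) If $G$ has exactly two diagonal edges, then $\rho(G)$ is separable if and only if these two edges are $\{(i,j),(k,l)\}$ and $\{(i,l),(k,j)\}$ for some rows $i\neq k$ and columns $j\neq l$. (2) If $G$ has exactly three diagonal edges, then $\rho(G)$ is separable if and only if either (a) there are rows $i\neq k$ and pairwise distinct columns $j_1,j_2,j_3$ such that the diagonal edges are $\{(i,j_1),(k,j_2)\}$, $\{(i,j_2),(k,j_3)\}$, $\{(k,j_1),(i,j_3)\}$; or (b) there are pairwise distinct rows $i_1,i_2,i_3$ and columns $j\neq l$ such that the diagonal edges are $\{(i_1,j),(i_2,l)\}$, $\{(i_2,j),(i_3,l)\}$, $\{(i_1,l),(i_3,j)\}$.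
   Context: A grid-labelled graph of type $(a,b)$ is a simple graph $G$ whose vertex set is the grid $[a]\times[b]$. If $G$ has $m\ge1$ edges, $\rho(G)=L(G)/(2m)$, where $L(G)$ is the combinatorial Laplacian, viewed as a density matrix on $\mathbb{C}^a\otimes\mathbb{C}^b$ with vertex $(i,j)$ corresponding to $|i\rangle\otimes|j\rangle$; separable means a convex combination of tensor products of density matrices. An edge $\{(i,j),(k,l)\}$ is horizontal if $i=k$, vertical if $j=l$, and diagonal if $i\neq k$ and $j\neq l$. *)

(* Defs.v *)
From HB Require Import structures.
From mathcomp Require Import all_boot all_order all_algebra.
Set Implicit Arguments. Unset Strict Implicit. Unset Printing Implicit Defensive.
Import Order.TTheory GRing.Theory Num.Theory.
Local Open Scope ring_scope.

(* Operators on the finite-dimensional Hilbert space C^T with orthonormal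
   basis (|x>)_{x : T}, represented by their matrix entries  M x y = <x|M|y>.
   C is an (ordered) algebraically closed field with conjugation, e.g. algC. *)
Definition op (C : numClosedFieldType) (T : finType) := T -> T -> C.

Definition hermitian_op (C : numClosedFieldType) (T : finType) (M : op C T) :=
  forall x y, M y x = (M x y)^*.

Definition psd_op (C : numClosedFieldType) (T : finType) (M : op C T) :=
  hermitian_op M /\
  forall v : T -> C, 0 <= \sum_(x : T) \sum_(y : T) (v x)^* * M x y * v y.

Definition trace_op (C : numClosedFieldType) (T : finType) (M : op C T) :=
  \sum_(x : T) M x x.

Definition density_op (C : numClosedFieldType) (T : finType) (M : op C T) :=
  psd_op M /\ trace_op M = 1.

Definition tensor_op (C : numClosedFieldType) (A B : finType)
  (X : op C A) (Y : op C B) : op C (A * B)%type :=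
  fun p q => X p.1 q.1 * Y p.2 q.2.

Definition separable (C : numClosedFieldType) (a b : nat)
  (rho : op C ('I_a * 'I_b)%type) :=
  exists (N : nat) (p : 'I_N -> C) (X : 'I_N -> op C 'I_a) (Y : 'I_N -> op C 'I_b),
    [/\ forall k, 0 <= p k,
        \sum_(k < N) p k = 1,
        forall k, density_op (X k),
        forall k, density_op (Y k) &
        forall u v, rho u v = \sum_(k < N) p k * tensor_op (X k) (Y k) u v].

(* grid-labelled graphs of type (a,b): simple graphs on [a] x [b],
   given by a symmetric irreflexive adjacency relation *)
Definition vert (a b : nat) := ('I_a * 'I_b)%type.

Definition simple_graph (T : finType) (e : rel T) :=
  (forall x, ~~ e x x) /\ (forall x y, e x y = e y x).

Definition edges (T : finType) (e : rel T) : {set {set T}} :=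
  [set E : {set T} | [exists x, exists y, e x y && (E == [set x; y])]].

Definition num_edges (T : finType) (e : rel T) : nat := #|edges e|.

Definition degree (T : finType) (e : rel T) (x : T) : nat := #|[set y | e x y]|.

Definition laplacian (C : numClosedFieldType) (T : finType) (e : rel T) : op C T :=
  fun x y => if x == y then (degree e x)%:R else if e x y then -1 else 0.

Definition rho (C : numClosedFieldType) (a b : nat) (e : rel (vert a b))
  : op C (vert a b) :=
  fun x y => laplacian C e x y / (2 * num_edges e)%:R.

Definition diag_edges (a b : nat) (e : rel (vert a b)) : {set {set vert a b}} :=
  [set E : {set vert a b} | [exists x, exists y,
     [&& e x y, x.1 != y.1, x.2 != y.2 & E == [set x; y]]]].

(* Main.v *)
Require Import Defs.
From HB Require Import structures.
From mathcomp Require Import all_boot all_order all_algebra.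
From mathcomp Require Import ring.
Set Implicit Arguments. Unset Strict Implicit. Unset Printing Implicit Defensive.
Import Order.TTheory GRing.Theory Num.Theory.
Local Open Scope ring_scope.

(* Necessity is the degree criterion.  The all-ones vector is a product vector
   in the kernel of L(G), so every term X (x) Y of a separable decomposition has
   X 1 = 0 or Y 1 = 0; hence the all-ones vector is also in the kernel of the
   partial transpose of rho(G).  Read entrywise, each vertex (i, j) lies on as
   many diagonal edges {(i, j), (k, l)} as there are diagonal edges
   {(i, l), (k, j)}; for two or three diagonal edges this already forces the
   listed configurations.  Conversely, L(G) is the sum of the edge projectors:
   horizontal and vertical edges are product vectors, and each listed
   configuration is a sum of product projectors by diagonalizing the (cyclic)
   permutation of the columns, or rows, that it defines. *)

(** * The cone of separable operators *)

Section SeparableCone.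
Variables (C : numClosedFieldType).

Definition normsq (T : finType) (x : T -> C) := \sum_a x a * (x a)^*.

(** The zero vector cannot be normalized; it gets the projector onto [a0] by default, since even a
    term of weight zero needs a density operator. *)
Definition normalized_projector (T : finType) (a0 : T) (x : T -> C) : op C T :=
  if normsq x == 0 then fun a b => ((a == a0) && (b == a0))%:R
  else fun a b => x a * (x b)^* / normsq x.

Lemma normsq_ge0 (T : finType) (x : T -> C) : 0 <= normsq x.
Proof. by apply: sumr_ge0 => a _; rewrite mul_conjC_ge0. Qed.

Lemma normsq_eq0 (T : finType) (x : T -> C) a : normsq x = 0 -> x a = 0.
Proof.
move/eqP; rewrite psumr_eq0; last by move=> b _; rewrite mul_conjC_ge0.
by move/allP/(_ a (mem_index_enum a)); rewrite /= mul_conjC_eq0 => /eqP.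
Qed.

Lemma normalized_projectorE (T : finType) (a0 : T) (x : T -> C) a b :
  normsq x * normalized_projector a0 x a b = x a * (x b)^*.
Proof.
rewrite /normalized_projector; case: eqP => [x0|/eqP nx0].
  by rewrite x0 (normsq_eq0 a x0) !mul0r.
by rewrite mulrC divfK.
Qed.

Lemma normalized_projector_density (T : finType) (a0 : T) (x : T -> C) :
  density_op (normalized_projector a0 x).
Proof.
have nr : (normsq x)^* = normsq x.
  by apply/CrealP/ger0_real/normsq_ge0.
rewrite /normalized_projector; case: eqP => [x0|/eqP nx0]; split; first 1 last.
- rewrite /trace_op (bigD1 a0) //= eqxx big1 ?addr0 // => i /negPf ->.
  by [].
- split=> [a b|v]; first by rewrite !rmorphM fmorphV /= conjCK nr [x b * _]mulrC.
  have -> : \sum_a \sum_b (v a)^* * (x a * (x b)^* / normsq x) * v b =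
      (\sum_a (v a)^* * x a) * (\sum_a (v a)^* * x a)^* / normsq x.
    rewrite rmorph_sum /= mulr_suml mulr_suml; apply: eq_bigr => a _.
    rewrite mulr_sumr mulr_suml; apply: eq_bigr => b _.
    by rewrite rmorphM /= conjCK; ring.
  by rewrite mulr_ge0 ?mul_conjC_ge0 // invr_ge0 normsq_ge0.
- by rewrite /trace_op -mulr_suml divff.
split=> [a b|v]; first by rewrite andbC conjC_nat.
rewrite (bigD1 a0) //= [X in _ + X]big1 ?addr0; last first.
  by move=> i /negPf ne; rewrite big1 // => j _; rewrite ne /= mulr0 mul0r.
rewrite (bigD1 a0) //= [X in _ + X]big1 ?addr0; last first.
  by move=> i /negPf ne; rewrite ne andbF mulr0 mul0r.
by rewrite eqxx mulr1 mulrC mul_conjC_ge0.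
Qed.

Section Cone.
Variables (m n : nat).
Notation V := (vert m n).

Definition product_term (t : C * (('I_m -> C) * ('I_n -> C))) : op C V :=
  fun u v => t.1 * (t.2.1 u.1 * t.2.2 u.2 * (t.2.1 v.1 * t.2.2 v.2)^*).

(** Separability without normalization, so that sums and nonnegative multiples require no
    bookkeeping of traces. *)
Definition separable_cone (M : op C V) :=
  exists s, all (fun t => 0 <= t.1) s /\
    forall u v, M u v = \sum_(t <- s) product_term t u v.

Lemma eq_separable_cone (M M' : op C V) :
  (forall u v, M u v = M' u v) -> separable_cone M -> separable_cone M'.
Proof. by move=> E [s [s0 Es]]; exists s; split=> // u v; rewrite -E. Qed.

Lemma separable_coneD (M M' : op C V) :
  separable_cone M -> separable_cone M' ->
  separable_cone (fun u v => M u v + M' u v).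
Proof.
move=> [s [s0 Es]] [s' [s0' Es']]; exists (s ++ s').
by split=> [|u v]; rewrite ?all_cat ?s0 // big_cat -Es -Es'.
Qed.

Lemma separable_coneZ (c : C) (M : op C V) :
  0 <= c -> separable_cone M -> separable_cone (fun u v => c * M u v).
Proof.
move=> c0 [s [s0 Es]]; exists [seq (c * t.1, t.2) | t <- s]; split.
  by rewrite all_map; apply: sub_all s0 => t t0; apply: mulr_ge0.
move=> u v; rewrite Es big_map mulr_sumr; apply: eq_bigr => t _.
by rewrite /product_term /= mulrA.
Qed.

Lemma separable_cone_product (x : 'I_m -> C) (y : 'I_n -> C) :
  separable_cone (fun u v => x u.1 * y u.2 * (x v.1 * y v.2)^*).
Proof.
exists [:: (1, (x, y))]; split=> [|u v] /=; first by rewrite ler01.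
by rewrite big_seq1 /product_term mul1r.
Qed.

Lemma separable_cone_sum (I : Type) (r : seq I) (P : pred I) (F : I -> op C V) :
  (forall i, P i -> separable_cone (F i)) ->
  separable_cone (fun u v => \sum_(i <- r | P i) F i u v).
Proof.
move=> HF; elim: r => [|i r IH].
  by exists [::]; split=> // u v; rewrite !big_nil.
case Pi: (P i); last by apply: eq_separable_cone IH => u v; rewrite big_cons Pi.
apply: eq_separable_cone (separable_coneD (HF i Pi) IH) => u v.
by rewrite big_cons Pi.
Qed.

(** Normalizing both factors of a term turns its trace into its probability; the trace condition on
    [M] makes the probabilities sum to one. *)
Lemma separable_cone_separable (M : op C V) :
  (0 < m)%N -> (0 < n)%N -> separable_cone M -> trace_op M = 1 -> separable M.
Proof.
move=> m0 n0 [s [s0 Es]] trM.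
pose t k := tnth (in_tuple s) k.
exists (size s), (fun k => (t k).1 * normsq (t k).2.1 * normsq (t k).2.2).
exists (fun k => normalized_projector (Ordinal m0) (t k).2.1).
exists (fun k => normalized_projector (Ordinal n0) (t k).2.2).
split; last first.
- move=> u v; rewrite Es big_tnth; apply: eq_bigr => k _.
  have := normalized_projectorE (Ordinal m0) (t k).2.1 u.1 v.1.
  have := normalized_projectorE (Ordinal n0) (t k).2.2 u.2 v.2.
  rewrite /tensor_op /product_term rmorphM /= -/(t k) => E1 E2.
  transitivity ((t k).1 * ((t k).2.1 u.1 * ((t k).2.1 v.1)^*) *
                ((t k).2.2 u.2 * ((t k).2.2 v.2)^*)); first by ring.
  by rewrite -E1 -E2; ring.
- by move=> k; apply: normalized_projector_density.
- by move=> k; apply: normalized_projector_density.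
- rewrite -trM /trace_op; under [RHS]eq_bigr do rewrite Es.
  rewrite exchange_big [RHS]big_tnth; apply: eq_bigr => k _.
  rewrite /normsq -mulrA mulr_suml -mulr_sumr; congr (_ * _).
  rewrite -(pair_bigA _ (fun a b => (t k).2.1 a * (t k).2.2 b *
     ((t k).2.1 a * (t k).2.2 b)^*)) /=.
  apply: eq_bigr => a _; rewrite mulr_sumr; apply: eq_bigr => b _.
  by rewrite rmorphM /=; ring.
- move=> k; rewrite !mulr_ge0 ?normsq_ge0 //.
  exact: (elimT (@all_tnthP _ _ _ (in_tuple s)) s0).
Qed.

End Cone.
End SeparableCone.

(** * Laplacians as sums of edge projectors *)

Section Laplacian.
Variables (C : numClosedFieldType) (T : finType) (e : rel T).
Hypothesis eG : simple_graph e.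

Definition delta (x u : T) : C := (u == x)%:R.

Definition edge_form (p : T * T) (u v : T) : C :=
  (delta p.1 u - delta p.2 u) * (delta p.1 v - delta p.2 v).

Lemma eq_set2 (x y x' y' : T) : ([set x; y] == [set x'; y']) =
  ((x, y) == (x', y')) || ((x, y) == (y', x')).
Proof.
rewrite !xpair_eqE; apply/eqP/orP => [E|[]/andP[/eqP-> /eqP->] //]; last first.
  by rewrite setUC.
have := set22 x' y'; have := set21 x' y'; rewrite -E !inE.
have := set22 x y; have := set21 x y; rewrite {}E !inE.
case: (eqVneq x x') => [xx'|nx] /= xE yE x'E y'E.
  left; case/orP: yE => // /eqP yx'.
  by case/orP: y'E => /eqP ->; rewrite ?eqxx // yx' xx'.
by right; rewrite xE eq_sym.
Qed.

(** The sum runs over ordered pairs, so every edge occurs twice; hence the factor 1/2. *)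
Lemma laplacianE u v :
  laplacian C e u v = 2^-1 * \sum_(p | e p.1 p.2) edge_form p u v.
Proof.
have [irr sym] := eG.
have degE x : (degree e x)%:R = \sum_y (e x y)%:R :> C.
  by rewrite /degree -sum1dep_card big_mkcond natr_sum; apply: eq_bigr => y _; case: (e x y).
have S1 x (F : T -> C) : \sum_y delta y x * F y = F x.
  rewrite (bigD1 x) //= /delta eqxx mul1r big1 ?addr0 // => y /negPf.
  by rewrite eq_sym => ->; rewrite mul0r.
have -> : \sum_(p | e p.1 p.2) edge_form p u v =
  \sum_x \sum_y (e x y)%:R * edge_form (x, y) u v.
  rewrite pair_bigA big_mkcond; apply: eq_bigr => -[x y] _ /=.
  by case: (e x y); rewrite ?mul1r ?mul0r.
have -> : \sum_x \sum_y (e x y)%:R * edge_form (x, y) u v =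
  \sum_x delta x u * (delta x v * (degree e x)%:R)
  + \sum_x delta x u * (delta x v * (degree e x)%:R)
  - (\sum_x delta x u * (\sum_y delta y v * (e x y)%:R)
  + \sum_x delta x v * (\sum_y delta y u * (e x y)%:R)).
  have -> : \sum_x \sum_y (e x y)%:R * edge_form (x, y) u v =
   \sum_x \sum_y delta x u * (delta x v * (e x y)%:R)
   + \sum_y \sum_x delta y u * (delta y v * (e x y)%:R)
   - (\sum_x \sum_y delta x u * (delta y v * (e x y)%:R)
   +  \sum_x \sum_y delta x v * (delta y u * (e x y)%:R)).
    rewrite [X in _ + X - _]exchange_big -!big_split -sumrB.
    apply: eq_bigr => x _; rewrite -!big_split -sumrB; apply: eq_bigr => y _.
    by rewrite /edge_form /=; ring.
  congr (_ + _ - (_ + _)); apply: eq_bigr => x _; rewrite ?degE !mulr_sumr //.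
  by apply: eq_bigr => y _; rewrite sym.
rewrite !S1 /laplacian /delta [v == u]eq_sym [e v u]sym.
case: eqVneq => [->|uv]; first by rewrite (negPf (irr v)) /=; field.
by case: (e u v) => /=; field.
Qed.

(** Forgetting the order maps adjacent ordered pairs onto edges, and irreflexivity gives every fibre
    exactly two elements. *)
Lemma handshake : (\sum_x degree e x = 2 * num_edges e)%N.
Proof.
have [irr sym] := eG.
rewrite /degree; under eq_bigr do rewrite -sum1dep_card.
rewrite pair_big_dep /=.
rewrite (partition_big (fun p => [set p.1; p.2]) (mem (edges e))) /=; last first.
  move=> [x y] /= exy; rewrite inE; apply/existsP; exists x; apply/existsP; exists y.
  by rewrite exy eqxx.
rewrite /num_edges mulnC -sum_nat_const; apply: eq_bigr => E.
rewrite inE => /existsP[x /existsP[y /andP[exy /eqP->]]].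
rewrite sum1dep_card -(_ : #|[set (x, y); (y, x)]| = 2)%N; last first.
  rewrite cards2 xpair_eqE; case: eqVneq exy => // ->.
  by rewrite (negPf (irr _)).
congr #|pred_of_set _|; apply/setP => -[a b]; rewrite !inE /= eq_set2.
case: eqP => [[-> ->]|_]; first by rewrite exy.
by case: eqP => [[-> ->]|_]; rewrite ?andbF // sym exy.
Qed.

End Laplacian.

(** * Explicit product decompositions of edge forms *)

Section ProductForms.
Variables (C : numClosedFieldType) (m n : nat).
Notation V := (vert m n).

Lemma delta_pair (i : 'I_m) (j : 'I_n) (u : V) :
  delta C (i, j) u = delta C i u.1 * delta C j u.2.
Proof.
by case: u => a b; rewrite /delta xpair_eqE; case: (a == i); rewrite ?mul1r ?mul0r.
Qed.

Lemma conj_delta (T : finType) (x u : T) : (delta C x u)^* = delta C x u.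
Proof. by rewrite /delta conjC_nat. Qed.

Lemma edge_form_swap (T : finType) (p : T * T) u v :
  edge_form C (p.2, p.1) u v = edge_form C p u v.
Proof. by rewrite /edge_form /=; ring. Qed.

(** The edge vector factors as |i>(|j> - |l>) or (|i> - |k>)|j>. *)
Lemma separable_cone_grid_edge (p : V * V) :
  (p.1.1 == p.2.1) || (p.1.2 == p.2.2) -> separable_cone (edge_form C p).
Proof.
case: p => -[i j] [k l] /= /orP[] /eqP <-; rewrite /edge_form /=.
  apply: eq_separable_cone (separable_cone_product
    (delta C i) (fun b => delta C j b - delta C l b)) => u v.
  by rewrite !delta_pair rmorphM rmorphB /= !conj_delta; ring.
apply: eq_separable_cone (separable_cone_product
  (fun a => delta C i a - delta C k a) (delta C j)) => u v.
by rewrite !delta_pair rmorphM rmorphB /= !conj_delta; ring.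
Qed.

(* With a, b the two edge vectors, the product vectors
   (|i> + |k>)(|j> - |l>) = a - b and (|i> - |k>)(|j> + |l>) = a + b
   have projectors adding up to 2 (a a^* + b b^* ). *)
Lemma separable_cone_cross (i k : 'I_m) (j l : 'I_n) :
  separable_cone (fun u v => edge_form C ((i, j), (k, l)) u v +
                             edge_form C ((i, l), (k, j)) u v).
Proof.
have h0 : 0 <= 2^-1 :> C by rewrite invr_ge0 ler0n.
have := separable_coneZ h0 (separable_coneD
  (separable_cone_product (fun a => delta C i a + delta C k a)
                          (fun b => delta C j b - delta C l b))
  (separable_cone_product (fun a => delta C i a - delta C k a)
                          (fun b => delta C j b + delta C l b))).
apply: eq_separable_cone => u v; rewrite /edge_form /= !delta_pair.
by rewrite !rmorphM !rmorphD /= !rmorphN /= !conj_delta; field.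
Qed.

(** The square and the conjugate of w are both the other primitive root, written as a polynomial in
    w for use by [ring]. *)
Lemma primitive_cube_root : exists w : C, w ^+ 2 = - 1 - w /\ w^* = - 1 - w.
Proof.
pose s : C := sqrtC 3.
have sr : s^* = s by apply/CrealP; rewrite sqrtC_real ?ler0n.
have E : ('i * s) ^+ 2 = - 3 :> C by rewrite exprMn sqrCi sqrtCK; ring.
exists ((- 1 + 'i * s) / 2); split.
  transitivity ((1 - 2 * ('i * s) + ('i * s) ^+ 2) / 4); first by field.
  by rewrite E; field.
rewrite !rmorphM fmorphV rmorphD rmorphN rmorphM rmorph1 rmorph_nat /= conjCi sr.
by field.
Qed.

(* The coordinates [a b] (resp. [c1 c2 c3]) of a vertex are the indicators of
   its two rows (resp. three columns); the product vectors are the discrete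
   Fourier basis in the columns, twisted by the eigenvalue in the rows. *)
Lemma fourier_identity (w a b c1 c2 c3 a' b' c1' c2' c3' : C) :
  w ^+ 2 = - 1 - w ->
  let W := - 1 - w in
  3^-1 * ((a - b) * (c1 + c2 + c3) * ((a' - b') * (c1' + c2' + c3')) +
   ((a - W * b) * (c1 + w * c2 + W * c3) *
    ((a' - w * b') * (c1' + W * c2' + w * c3')) +
    (a - w * b) * (c1 + W * c2 + w * c3) *
    ((a' - W * b') * (c1' + w * c2' + W * c3')))) =
  (a * c1 - b * c2) * (a' * c1' - b' * c2') +
  ((a * c2 - b * c3) * (a' * c2' - b' * c3') +
   (b * c1 - a * c3) * (b' * c1' - a' * c3')).
Proof.
move=> w2 W; rewrite /W.
(* Multiplying by 3 leaves a polynomial identity, checked modulo the equation for w. *)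
apply: (can_inj (mulfK (_ : 3 != 0 :> C))); first by rewrite pnatr_eq0.
rewrite mulrAC mulVf ?pnatr_eq0 // mul1r.
ring: w2.
Qed.

(** For the cyclic shift P : j1 -> j2 -> j3 -> j1, the edge vectors are |i>|j> - |k>|P j> up to
    sign. Replacing |j> by an eigenvector f of P with eigenvalue s gives the product (|i> - s|k>) f;
    the factor 1/3 normalizes the Fourier vectors. *)
Lemma separable_cone_row_triple (i k : 'I_m) (j1 j2 j3 : 'I_n) :
  separable_cone (fun u v => edge_form C ((i, j1), (k, j2)) u v +
    (edge_form C ((i, j2), (k, j3)) u v + edge_form C ((k, j1), (i, j3)) u v)).
Proof.
have [w [w2 cw]] := primitive_cube_root; pose W : C := - 1 - w.
have cW : W^* = w by rewrite /W rmorphB rmorphN rmorph1 /= cw; ring.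
have h0 : 0 <= 3^-1 :> C by rewrite invr_ge0 ler0n.
pose x s a := delta C i a - s * delta C k a.
pose y s t b := delta C j1 b + s * delta C j2 b + t * delta C j3 b.
have := separable_coneZ h0 (separable_coneD (separable_cone_product (x 1) (y 1 1))
  (separable_coneD (separable_cone_product (x W) (y w W))
                   (separable_cone_product (x w) (y W w)))).
apply: eq_separable_cone => u v; rewrite /edge_form /= !delta_pair.
rewrite -(fourier_identity _ _ _ _ _ _ _ _ _ _ w2) -/W.
rewrite /x /y !rmorphM !rmorphD /= !rmorphN /= !rmorphM /= !conj_delta cw cW.
by rewrite rmorph1 !mul1r.
Qed.

Lemma separable_cone_column_triple (i1 i2 i3 : 'I_m) (j l : 'I_n) :
  separable_cone (fun u v => edge_form C ((i1, j), (i2, l)) u v +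
    (edge_form C ((i2, j), (i3, l)) u v + edge_form C ((i1, l), (i3, j)) u v)).
Proof.
have [w [w2 cw]] := primitive_cube_root; pose W : C := - 1 - w.
have cW : W^* = w by rewrite /W rmorphB rmorphN rmorph1 /= cw; ring.
have h0 : 0 <= 3^-1 :> C by rewrite invr_ge0 ler0n.
pose x s b := delta C j b - s * delta C l b.
pose y s t a := delta C i1 a + s * delta C i2 a + t * delta C i3 a.
have := separable_coneZ h0 (separable_coneD (separable_cone_product (y 1 1) (x 1))
  (separable_coneD (separable_cone_product (y w W) (x W))
                   (separable_cone_product (y W w) (x w)))).
apply: eq_separable_cone => u v; rewrite /edge_form /= !delta_pair.
(* With the column factor in front, the two columns take the place of the two rows in
   [fourier_identity]. *)
rewrite ![delta C _ u.1 * _]mulrC ![delta C _ v.1 * _]mulrC.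
rewrite -(fourier_identity _ _ _ _ _ _ _ _ _ _ w2) -/W.
rewrite /x /y !rmorphM !rmorphD /= !rmorphN /= !rmorphM /= !conj_delta cw cW.
by rewrite rmorph1 !mul1r ![_ * (delta C j _ - _)]mulrC.
Qed.

End ProductForms.

(** * Separability of grid-labelled graphs *)

Section SeparableGraph.
Variables (C : numClosedFieldType) (m n : nat) (e : rel (vert m n)).
Notation V := (vert m n).
Hypothesis eG : simple_graph e.

Definition diag (x y : V) := [&& e x y, x.1 != y.1 & x.2 != y.2].

Lemma mem_diag_edges x y : ([set x; y] \in diag_edges e) = diag x y.
Proof.
have [_ sym] := eG; rewrite inE; apply/existsP/idP => [[a /existsP[b]]|d].
  case/and4P=> eab ab1 ab2; rewrite eq_set2 /diag => /orP[] /eqP[-> ->].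
    by rewrite eab ab1.
  by rewrite sym eab [b.1 == _]eq_sym ab1 eq_sym.
exists x; apply/existsP; exists y; rewrite eqxx andbT.
by case/and3P: d => -> -> ->.
Qed.

Lemma diag_edgesP E : E \in diag_edges e -> exists x y, E = [set x; y] /\ diag x y.
Proof.
rewrite inE => /existsP[x /existsP[y /and4P[exy xy1 xy2 /eqP->]]].
by exists x, y; split=> //; rewrite /diag exy xy1.
Qed.

Lemma num_edges_gt0 x y : e x y -> (0 < num_edges e)%N.
Proof.
move=> exy; rewrite card_gt0; apply/set0Pn; exists [set x; y].
by rewrite inE; apply/existsP; exists x; apply/existsP; exists y; rewrite exy eqxx.
Qed.

Lemma trace_rho : (0 < num_edges e)%N -> trace_op (rho C e) = 1.
Proof.
move=> e0; rewrite /trace_op /rho /laplacian -mulr_suml.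
under eq_bigr do rewrite eqxx.
by rewrite -natr_sum (handshake eG) divff // pnatr_eq0 muln_eq0 -lt0n.
Qed.

(** [s] holds each diagonal edge in one orientation. All other edges are product vectors, so only
    the diagonal part must be shown separable; nonemptiness provides an edge, hence trace one. *)
Lemma separable_rho (s : seq (V * V)) :
  s != [::] ->
  (forall x y, diag x y = ((x, y) \in s ++ [seq (p.2, p.1) | p <- s])) ->
  uniq (s ++ [seq (p.2, p.1) | p <- s]) ->
  separable_cone (fun u v => \sum_(p <- s) edge_form C p u v) ->
  separable (rho C e).
Proof.
move=> s0 ds us cs.
have [x [y dxy]] : exists x y, diag x y.
  case: s s0 ds {us cs} => // -[x y] s _ ds; exists x, y.
  by rewrite ds mem_head.
have e0 : (0 < num_edges e)%N by case/and3P: dxy => /num_edges_gt0.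
have m0 : (0 < m)%N := leq_ltn_trans (leq0n _) (ltn_ord x.1).
have n0 : (0 < n)%N := leq_ltn_trans (leq0n _) (ltn_ord x.2).
apply: (separable_cone_separable m0 n0 _ (trace_rho e0)).
have h0 : 0 <= 2^-1 :> C by rewrite invr_ge0 ler0n.
have c0 : 0 <= ((2 * num_edges e)%:R : C)^-1 by rewrite invr_ge0 ler0n.
have cnd : separable_cone (fun u v => 2^-1 *
    \sum_(p | e p.1 p.2 && ~~ diag p.1 p.2) edge_form C p u v).
  apply: separable_coneZ h0 _; apply: separable_cone_sum => p /andP[ep].
  by rewrite /diag ep /= negb_and !negbK; apply: separable_cone_grid_edge.
apply: eq_separable_cone (separable_coneZ c0 (separable_coneD cnd cs)) => u v.
rewrite /rho (laplacianE C eG) mulrC; congr (_ / _).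
rewrite [X in _ = _ * X](bigID (fun p => diag p.1 p.2)) /= mulrDr [RHS]addrC; congr (_ + _).
have -> : \sum_(p | e p.1 p.2 && diag p.1 p.2) edge_form C p u v =
    \sum_(p <- s ++ [seq (p.2, p.1) | p <- s]) edge_form C p u v.
  rewrite big_uniq //; apply: eq_bigl => -[a b] /=; rewrite -ds.
  by rewrite /diag; case: (e a b).
(* Both orientations contribute equally, which cancels the factor 1/2. *)
rewrite big_cat big_map /=; under [X in _ + X]eq_bigr do rewrite edge_form_swap.
by field.
Qed.

(** * Kernels and the degree criterion *)

Lemma psd_form_ge0 (T : finType) (X : op C T) :
  psd_op X -> 0 <= \sum_x \sum_y X x y.
Proof.
case=> _ /(_ (fun=> 1)); congr (_ <= _).
by apply: eq_bigr => x _; apply: eq_bigr => y _; rewrite rmorph1 mul1r mulr1.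
Qed.

(** The form has its minimum 0 at the all-ones vector, so perturbing along |a> can have no
    first-order term. *)
Lemma psd_kernel (T : finType) (X : op C T) :
  psd_op X -> \sum_x \sum_y X x y = 0 -> forall a, \sum_y X a y = 0.
Proof.
case=> herm psd tot a.
have Q (c : C) : \sum_x \sum_y (1 + c * delta C a x)^* * X x y * (1 + c * delta C a y)
    = c^* * (\sum_y X a y) + c * (\sum_y X a y)^* + c^* * c * X a a.
  have S (F : T -> C) : \sum_y delta C a y * F y = F a.
    rewrite (bigD1 a) //= /delta eqxx mul1r big1 ?addr0 // => y /negPf ->.
    by rewrite mul0r.
  transitivity (\sum_x \sum_y X x y + c * (\sum_x \sum_y delta C a y * X x y)
    + c^* * (\sum_x delta C a x * (\sum_y X x y))
    + c^* * c * (\sum_x delta C a x * (\sum_y delta C a y * X x y))).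
    rewrite !mulr_sumr -!big_split; apply: eq_bigr => x _.
    rewrite !mulr_sumr -!big_split; apply: eq_bigr => y _ /=.
    by rewrite rmorphD rmorph1 rmorphM /= conj_delta; ring.
  rewrite tot !S; under eq_bigr do rewrite S.
  have -> : \sum_x X x a = (\sum_y X a y)^*.
    by rewrite rmorph_sum; apply: eq_bigr => y _; rewrite herm.
  by ring.
have Xaa : 0 <= X a a.
  have := psd (delta C a); congr (_ <= _).
  rewrite (bigD1 a) //= [X in _ + X]big1 ?addr0; last first.
    by move=> x /negPf xa; rewrite big1 // => y _; rewrite conj_delta /delta xa !mul0r.
  rewrite (bigD1 a) //= [X in _ + X]big1 ?addr0; last first.
    by move=> x /negPf xa; rewrite /delta xa mulr0.
  by rewrite conj_delta /delta eqxx mulr1 mul1r.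
set r := \sum_y X a y in Q *.
have X1 : 0 < X a a + 1 by rewrite ltr_wpDl.
have X1r : ((X a a + 1)^-1)^* = (X a a + 1)^-1.
  by apply/CrealP/ger0_real; rewrite invr_ge0 ltW.
(* Testing 1 - t r |a> with t = 1 / (X_aa + 1) makes the form negative unless r = 0. *)
have := psd (fun x => 1 + (- (X a a + 1)^-1 * r) * delta C a x).
rewrite {}Q rmorphM rmorphN /= X1r => pos.
apply/eqP; rewrite -mul_conjC_eq0 eq_le mul_conjC_ge0 andbT.
have X2 : 0 < X a a + 2 by rewrite ltr_wpDl.
(* The form at the test vector equals -|r|^2 (X_aa + 2) / (X_aa + 1)^2. *)
rewrite -(pmulr_rle0 _ X2) -(pmulr_rle0 _ (exprn_gt0 2 (_ : 0 < (X a a + 1)^-1))).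
  rewrite -oppr_ge0; move: pos; congr (_ <= _); field.
  by rewrite lt0r_neq0.
by rewrite invr_gt0.
Qed.

(* A term of the separable decomposition killing the all-ones product vector
   has a factor killing an all-ones vector, and conjugating one factor keeps
   this property. *)
Lemma separable_transpose_kernel (M : op C V) :
  separable M -> \sum_u \sum_v M u v = 0 ->
  forall i j, \sum_(v : V) M (i, v.2) (v.1, j) = 0.
Proof.
case=> N [p [X [Y [p0 _ Xd Yd ME]]]] tot i j.
pose x t := \sum_a \sum_b X t a b; pose y t := \sum_a \sum_b Y t a b.
have x0 t : 0 <= x t by apply/psd_form_ge0/(Xd t).1.
have y0 t : 0 <= y t by apply/psd_form_ge0/(Yd t).1.
(* These terms are nonnegative and add up to the vanishing total. *)
have H t : p t * (x t * y t) = 0.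
  have E : \sum_t p t * (x t * y t) = 0.
    rewrite -[RHS]tot; under [RHS]eq_bigr => u _ do under eq_bigr do rewrite ME.
    under [RHS]eq_bigr do rewrite exchange_big.
    rewrite exchange_big; apply: eq_bigr => s _; under [RHS]eq_bigr do rewrite -mulr_sumr.
    rewrite -mulr_sumr; congr (_ * _).
    rewrite -(pair_bigA _ (fun a b => \sum_v tensor_op (X s) (Y s) (a, b) v)) /=.
    rewrite /x mulr_suml; apply: eq_bigr => a _.
    rewrite /y mulr_sumr; apply: eq_bigr => b _.
    rewrite -(pair_bigA _ (fun a' b' => tensor_op (X s) (Y s) (a, b) (a', b'))) /=.
    by rewrite mulr_suml; apply: eq_bigr => a' _; rewrite mulr_sumr.
  move/eqP: E; rewrite psumr_eq0; last by move=> s _; rewrite !mulr_ge0.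
  by move=> /allP/(_ t (mem_index_enum t))/eqP.
under eq_bigr do rewrite ME; rewrite exchange_big big1 // => t _.
rewrite -mulr_sumr /tensor_op /=.
rewrite -(pair_bigA _ (fun a b => X t i a * Y t b j)) /=.
under eq_bigr do rewrite -mulr_sumr; rewrite -mulr_suml.
have /eqP := H t; rewrite !mulf_eq0 => /or3P[] /eqP z.
- by rewrite z mul0r.
- by rewrite (psd_kernel (Xd t).1 z) mul0r mulr0.
have -> : \sum_b Y t b j = (\sum_b Y t j b)^*.
  by rewrite rmorph_sum; apply: eq_bigr => b _; rewrite (Yd t).1.1.
by rewrite (psd_kernel (Yd t).1 z) conjC0 !mulr0.
Qed.

Lemma laplacian_row_sum u : \sum_v laplacian C e u v = 0.
Proof.
under eq_bigr do rewrite (laplacianE C eG).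
rewrite -mulr_sumr exchange_big big1 ?mulr0 // => p _.
rewrite /edge_form -mulr_sumr sumrB.
have S x : \sum_v delta C x v = 1 :> C.
  by rewrite (bigD1 x) //= /delta eqxx big1 ?addr0 // => y /negPf ->.
by rewrite !S subrr mulr0.
Qed.

(** The matrix row indexed by [x] sums to zero both in L(G) and in its partial transpose. This
    equates two counts of diagonal edges, of which only positivity is kept. *)
Lemma separable_diag_partner x y :
  separable (rho C e) -> diag x y -> exists k l, diag (x.1, l) (k, x.2).
Proof.
have [irr sym] := eG; case: x => i j /= sep dxy.
have c0 : (2 * num_edges e)%:R != 0 :> C.
  by rewrite pnatr_eq0 muln_eq0 -lt0n; case/and3P: dxy => /num_edges_gt0.
have tot : \sum_u \sum_v rho C e u v = 0.
  by rewrite big1 // => u _; rewrite -mulr_suml laplacian_row_sum mul0r.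
have := separable_transpose_kernel sep tot i j.
rewrite -mulr_suml => /eqP; rewrite mulf_eq0 invr_eq0 (negPf c0) orbF => /eqP E.
(* At vertices in grid row i or grid column j both matrices have the same entry, by symmetry;
   elsewhere the entries are -1 or 0 and detect diagonal edges. *)
have F : \sum_(v : V) (diag (i, v.2) (v.1, j))%:R =
         \sum_(v : V) (diag (i, j) v)%:R :> C.
  apply: oppr_inj; rewrite -!sumrN; apply/eqP; rewrite -subr_eq0; apply/eqP.
  transitivity (\sum_v laplacian C e (i, v.2) (v.1, j) - \sum_v laplacian C e (i, j) v);
    last by rewrite E laplacian_row_sum subrr.
  rewrite -!sumrB; apply: eq_bigr => -[k l] _ /=.
  rewrite /laplacian /diag !xpair_eqE /=.
  case: (eqVneq i k) => [->|ik] /=; last case: (eqVneq j l) => [->|jl] /=.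
  - rewrite !andbF /= [l == j]eq_sym; case: eqP => [->|_]; first by rewrite !subrr.
    by rewrite sym !subrr.
  - by rewrite !andbF subrr /= subrr.
  - by rewrite !andbT; case: (e _ _); case: (e _ _) => /=; ring.
suff /existsP[k /existsP[l dkl]] : [exists k, exists l, diag (i, l) (k, j)].
  by exists k, l.
apply: contraT => /existsPn H.
suff : 1 <= 0 :> C by rewrite ler10.
have -> : 0 = \sum_(v : V) (diag (i, j) v)%:R :> C.
  rewrite -F big1 // => -[k l] _ /=.
  by have /existsPn/(_ l)/negPf -> := H k.
by rewrite (bigD1 y) //= dxy lerDl sumr_ge0.
Qed.

End SeparableGraph.

(** * Configurations of two or three diagonal edges *)

Section Combinatorics.
Variables (m n : nat).
Notation V := (vert m n).

Definition off_axis (x y : V) := (x.1 != y.1) && (x.2 != y.2).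

Definition row_triple (D : {set {set V}}) :=
  exists (i k : 'I_m) (j1 j2 j3 : 'I_n),
    [/\ i != k, [&& j1 != j2, j1 != j3 & j2 != j3] &
      D = [set [set (i, j1); (k, j2)]; [set (i, j2); (k, j3)];
               [set (k, j1); (i, j3)]]].

Definition column_triple (D : {set {set V}}) :=
  exists (i1 i2 i3 : 'I_m) (j l : 'I_n),
    [/\ [&& i1 != i2, i1 != i3 & i2 != i3], j != l &
      D = [set [set (i1, j); (i2, l)]; [set (i2, j); (i3, l)];
               [set (i1, l); (i3, j)]]].

(** Edges are unordered, so the condition applies at both endpoints of each edge. *)
Definition partner_closed (D : {set {set V}}) :=
  forall x y, [set x; y] \in D -> exists k l, [set (x.1, l); (k, x.2)] \in D.

Ltac neq_absurd :=
  match goal with N : is_true (?x != ?x) |- _ => by rewrite eqxx in N end.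

Ltac edge_cases H :=
  move: H; rewrite !inE !eq_set2 => /orP[/orP[|]|] /orP[] /eqP[]; intros; subst;
  try neq_absurd.

Lemma cards3P (T : finType) (A : {set T}) : #|A| = 3%N ->
  exists x y z, A = [set x; y; z].
Proof.
move=> A3; have /card_gt0P[x xA] : (0 < #|A|)%N by rewrite A3.
have /eqP/cards2P[y [z [_ E]]] : #|A :\ x| = 2%N.
  by have := cardsD1 x A; rewrite xA A3 add1n => -[].
by exists x, y, z; rewrite -setUA -E setD1K.
Qed.

Lemma cards3_neq (T : finType) (x y z : T) :
  #|[set x; y; z]| = 3%N -> [&& x != y, x != z & y != z].
Proof.
rewrite -setUA cardsU1 cards2 !inE; case: (x == y); case: (x == z); case: (y == z) => //.
Qed.

(** The third edge is not its own partner, so its partners lie in the crossing pair. This puts both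
    its endpoints at corners of the rectangle, and being off-axis it coincides with one of the first
    two edges. *)
Lemma cross_edge_absurd (i k : 'I_m) (j l : 'I_n) (x3 y3 : V) :
  let D := [set [set (i, j); (k, l)]; [set (i, l); (k, j)]; [set x3; y3]] in
  #|D| = 3%N -> partner_closed D -> off_axis x3 y3 -> False.
Proof.
move=> D /cards3_neq/and3P[_ E13 E23] H /andP[n1 n2].
have mD : [set x3; y3] \in D by rewrite !inE eqxx !orbT.
have [a [b P]] := H _ _ mD.
have [a' [b' P']] : exists k l, [set (y3.1, l); (k, y3.2)] \in D.
  by apply: (H _ x3); rewrite setUC.
rewrite /D {H mD D} in P P'.
case: x3 y3 n1 n2 E13 E23 P P' => [p q] [r s] /= n1 n2 E13 E23 P P'.
by edge_cases P; edge_cases P'; move: E13 E23; rewrite !eq_set2 !eqxx ?orbT.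
Qed.

(** The second edge is the partner of the first at (i, j). The third must then be the partner at (k,
    l), and the conditions at (i, q), (p, j) and (r, l) leave two identifications of indices. *)
Lemma triple_classification_aux (i k p : 'I_m) (j l q : 'I_n) (x3 y3 : V) :
  let D := [set [set (i, j); (k, l)]; [set (i, q); (p, j)]; [set x3; y3]] in
  #|D| = 3%N -> partner_closed D ->
  i != k -> j != l -> i != p -> q != j -> off_axis x3 y3 ->
  row_triple D \/ column_triple D.
Proof.
move=> D D3 H ik jl ip qj off.
have cross : ~ (p = k /\ q = l).
  by case=> ? ?; subst; apply: (@cross_edge_absurd i k j l x3 y3).
have [r [s E3]] : exists r s, [set x3; y3] = [set (k, s); (r, l)].
  have [r [s]] : exists r s, [set (k, s); (r, l)] \in D.
    by apply: (H (k, l) (i, j)); rewrite !inE [[set (k, l); _]]setUC eqxx.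
  rewrite in_setU => /orP[|]; last by rewrite inE => /eqP <-; exists r, s.
  rewrite !inE !eq_set2 => /orP[] /orP[] /eqP[]; intros; subst; try neq_absurd.
  by case: cross.
have {off} /andP[kr sl] : (k != r) && (s != l).
  have /eqP := E3; rewrite eq_set2 => /orP[] /eqP[? ?]; subst; case/andP: off => /= a b.
    by rewrite a b.
  by rewrite eq_sym a eq_sym b.
rewrite {}/D {}E3 in D3 H *.
have [a [b P]] := H (i, q) (p, j) ltac:(by rewrite !inE eqxx !orbT).
have [a' [b' P']] := H (p, j) (i, q) ltac:(by rewrite !inE [[set (p, j); _]]setUC eqxx !orbT).
have [a'' [b'' P'']] := H (r, l) (k, s) ltac:(by rewrite !inE [[set (r, l); _]]setUC eqxx !orbT).
rewrite {H D3} /= in P P' P''.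
edge_cases P; edge_cases P'; edge_cases P''; try by case: cross.
(* The survivors are p = r, q = l, j = s, a column triple, and p = k, q = s, i = r, a row triple. *)
- right; exists i, k, r, s, l; split=> //; first by rewrite ik ip kr.
  by rewrite setUAC.
- left; exists r, k, j, l, s; split=> //.
    by rewrite jl [j == s]eq_sym qj [l == s]eq_sym sl.
  by rewrite setUAC [[set (k, s); _]]setUC [[set (r, s); _]]setUC.
Qed.

Lemma triple_classification (D : {set {set V}}) :
  #|D| = 3%N -> (forall x y, [set x; y] \in D -> off_axis x y) ->
  (forall E, E \in D -> exists x y, E = [set x; y]) -> partner_closed D ->
  row_triple D \/ column_triple D.
Proof.
move=> D3 off pairs H; have [E1 [E2 [E3 DE]]] := cards3P D3.
have [[i j] [[k l] E1E]] : exists x y, E1 = [set x; y].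
  by apply: pairs; rewrite DE !inE eqxx.
have /andP[/= ik jl] : off_axis (i, j) (k, l).
  by apply: off; rewrite -E1E DE !inE eqxx.
have [p [q /= PD]] : exists p q, [set (i, q); (p, j)] \in D.
  by apply: (H (i, j) (k, l)); rewrite -E1E DE !inE eqxx.
have /andP[/= ip qj] := off _ _ PD.
(* The partner at (i, j) is not [E1], and [E2] and [E3] are interchangeable. *)
wlog E2E : E2 E3 DE / [set (i, q); (p, j)] = E2.
  move=> W; move: (PD); rewrite {1}DE !inE => /orP[/orP[]|] /eqP.
  - rewrite E1E => /eqP; rewrite eq_set2 => /orP[] /eqP[]; intros; subst; neq_absurd.
  - exact: (W E2 E3 DE).
  - by move=> E; apply: (W E3 E2) E; rewrite DE setUAC.
have [x3 [y3 E3E]] : exists x y, E3 = [set x; y].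
  by apply: pairs; rewrite DE !inE eqxx orbT.
have off3 : off_axis x3 y3 by apply: off; rewrite -E3E DE !inE eqxx orbT.
rewrite E1E -E2E E3E in DE; rewrite DE in D3 H *.
exact: triple_classification_aux.
Qed.

(** The partners at (i, j) and at (k, l) must both be the second edge; comparing their two
    descriptions gives p = k and q = l. *)
Lemma pair_classification (D : {set {set V}}) :
  #|D| = 2%N -> (forall x y, [set x; y] \in D -> off_axis x y) ->
  (forall E, E \in D -> exists x y, E = [set x; y]) -> partner_closed D ->
  exists (i k : 'I_m) (j l : 'I_n), [/\ i != k, j != l &
    D = [set [set (i, j); (k, l)]; [set (i, l); (k, j)]]].
Proof.
move=> /eqP/cards2P[E1 [E2 [E12 DE]]] off pairs H.
have [[i j] [[k l] E1E]] : exists x y, E1 = [set x; y].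
  by apply: pairs; rewrite DE !inE eqxx.
have /andP[/= ik jl] : off_axis (i, j) (k, l).
  by apply: off; rewrite -E1E DE !inE eqxx.
have [p [q /= PD]] : exists p q, [set (i, q); (p, j)] \in D.
  by apply: (H (i, j) (k, l)); rewrite -E1E DE !inE eqxx.
have [r [s /= PD']] : exists r s, [set (k, s); (r, l)] \in D.
  by apply: (H (k, l) (i, j)); rewrite setUC -E1E DE !inE eqxx.
have E2E : [set (i, q); (p, j)] = E2.
  move: PD; rewrite DE !inE E1E => /orP[] /eqP // /eqP.
  by rewrite eq_set2 => /orP[] /eqP[];
    intros; subst; neq_absurd.
exists i, k, j, l; split=> //; rewrite DE E1E -E2E; congr [set _; _].
move: PD'; rewrite DE -E2E E1E !inE !eq_set2 => /orP[] /orP[] /eqP[];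
  by intros; subst; try neq_absurd.
Qed.
End Combinatorics.

(** * The configurations as diagonal edge sets of a graph *)

Section Classification.
Variables (C : numClosedFieldType) (m n : nat) (e : rel (vert m n)).
Hypothesis eG : simple_graph e.

Lemma diag_edges_off_axis x y : [set x; y] \in diag_edges e -> off_axis x y.
Proof. by rewrite mem_diag_edges // => /and3P[_ h1 h2]; apply/andP. Qed.

Lemma diag_edges_pair E : E \in diag_edges e -> exists x y, E = [set x; y].
Proof. by case/diag_edgesP=> x [y [-> _]]; exists x, y. Qed.

Lemma diag_edges_partner_closed :
  separable (rho C e) -> partner_closed (diag_edges e).
Proof.
move=> sep x y; rewrite mem_diag_edges // => dxy.
have [k [l dkl]] := separable_diag_partner eG sep dxy.
by exists k, l; rewrite mem_diag_edges.
Qed.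

Ltac decide_uniq :=
  rewrite /= !inE !xpair_eqE;
  repeat match goal with N : is_true (?x != ?y) |- _ =>
    rewrite ?(negPf N) ?[y == x]eq_sym ?(negPf N); clear N end;
  rewrite /= ?andbF ?andbT.

Lemma separable_cross (i k : 'I_m) (j l : 'I_n) : i != k -> j != l ->
  diag_edges e = [set [set (i, j); (k, l)]; [set (i, l); (k, j)]] ->
  separable (rho C e).
Proof.
move=> ik jl DE.
apply: (@separable_rho _ _ _ _ eG [:: ((i, j), (k, l)); ((i, l), (k, j))]) => //.
- move=> x y; rewrite -mem_diag_edges // DE !inE !eq_set2 /=.
  (* Both sides are disjunctions of the same four tests, one per oriented diagonal edge. *)
  by do 4 case: (_ == _).
- by decide_uniq.
by apply: eq_separable_cone (separable_cone_cross C i k j l) => u v;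
  rewrite !big_cons big_nil addr0.
Qed.

Lemma separable_row_triple :
  row_triple (diag_edges e) -> separable (rho C e).
Proof.
case=> i [k [j1 [j2 [j3 [ik /and3P[j12 j13 j23] DE]]]]].
apply: (@separable_rho _ _ _ _ eG
  [:: ((i, j1), (k, j2)); ((i, j2), (k, j3)); ((k, j1), (i, j3))]) => //.
- move=> x y; rewrite -mem_diag_edges // DE !inE !eq_set2 /=.
  by do 6 case: (_ == _).
- by decide_uniq.
apply: eq_separable_cone (separable_cone_row_triple C i k j1 j2 j3) => u v.
by rewrite !big_cons big_nil addr0.
Qed.

Lemma separable_column_triple :
  column_triple (diag_edges e) -> separable (rho C e).
Proof.
case=> i1 [i2 [i3 [j [l [/and3P[i12 i13 i23] jl DE]]]]].
apply: (@separable_rho _ _ _ _ eG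
  [:: ((i1, j), (i2, l)); ((i2, j), (i3, l)); ((i1, l), (i3, j))]) => //.
- move=> x y; rewrite -mem_diag_edges // DE !inE !eq_set2 /=.
  by do 6 case: (_ == _).
- by decide_uniq.
apply: eq_separable_cone (separable_cone_column_triple C i1 i2 i3 j l) => u v.
by rewrite !big_cons big_nil addr0.
Qed.

End Classification.

Theorem mainTheorem12 (C : numClosedFieldType) (m n : nat)
  (e : rel (vert m n)) :
  (1 < m)%N -> (1 < n)%N -> simple_graph e ->
  ((#|diag_edges e| = 2)%N ->
     (separable (rho C e) <->
      exists (i k : 'I_m) (j l : 'I_n), [/\ i != k, j != l &
        diag_edges e = [set [set (i, j); (k, l)]; [set (i, l); (k, j)]]])) /\
  ((#|diag_edges e| = 3)%N ->
     (separable (rho C e) <->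
      (exists (i k : 'I_m) (j1 j2 j3 : 'I_n),
         [/\ i != k, [&& j1 != j2, j1 != j3 & j2 != j3] &
           diag_edges e = [set [set (i, j1); (k, j2)]; [set (i, j2); (k, j3)];
                               [set (k, j1); (i, j3)]]]) \/
      (exists (i1 i2 i3 : 'I_m) (j l : 'I_n),
         [/\ [&& i1 != i2, i1 != i3 & i2 != i3], j != l &
           diag_edges e = [set [set (i1, j); (i2, l)]; [set (i2, j); (i3, l)];
                               [set (i1, l); (i3, j)]]]))).
Proof.
move=> _ _ eG; split=> card; split.
- move=> sep; apply: (pair_classification card); first exact: diag_edges_off_axis.
    exact: diag_edges_pair.
  exact: diag_edges_partner_closed sep.
- by case=> i [k [j [l [ik jl DE]]]]; apply: separable_cross DE.
- move=> sep; apply: (triple_classification card); first exact: diag_edges_off_axis.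
    exact: diag_edges_pair.
  exact: diag_edges_partner_closed sep.
by case; [apply: separable_row_triple | apply: separable_column_triple].
Qed.
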